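(* Let $G_{n,1/2}$ be the random graph on $n$ vertices. With high probability, $$HG(G_{n,1/2})\leq (1+o(1)) \left(\frac{1+\sqrt5}{4}\right)n .$$ That is, there is a function $\delta(n)$ with $\delta(n)\to 0$ as $n\to\infty$ such that $\Pr\left[HG(G_{n,1/2})\le (1+\delta(n))\frac{1+\sqrt5}{4}\,n\right]\to 1$ as $n\to\infty$.
   Context: $G_{n,1/2}$ denotes the random graph on $n$ labeled vertices in which each of the $\binom n2$ possible edges is present independently with probability $1/2$. ''With high probability'' means with probability tending to $1$ as $n\to\infty$. Graphs are finite and simple, with at least one vertex. Let $G$ be a graph on $n$ vertices and let $k\ge 1$ be an integer. A $k$-coloring of $G$ is an arbitrary (not necessarily proper) map $c:V(G)\to\{1,\ldots,k\}$ (hat colors). A guessing strategy $\mathcal{S}$ with $k$ colors is a deterministic rule assigning to each vertex $v$ a function that takes the colors $(c(w))_{w\in N(v)}$ of the neighbors of $v$ (not including $v$ itself) and outputs a guess in $\{1,\ldots,k\}$. Vertex $v$ guesses correctly in $c$ if its guess equals $c(v)$. The strategy is winning if for every $k$-coloring $c$ at least one vertex guesses correctly. The hat guessing number $HG(G)$ is the largest $k$ for which a winning guessing strategy with $k$ colors exists. *)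

(* Defs.v *)
From HB Require Import structures.
From mathcomp Require Import all_boot all_order all_algebra.
From mathcomp Require Import all_classical all_reals all_analysis.

Set Implicit Arguments.
Unset Strict Implicit.
Unset Printing Implicit Defensive.

Import Order.TTheory GRing.Theory Num.Theory.
Import numFieldNormedType.Exports.

Local Open Scope ring_scope.

Section SimpleGraphs.
Variable V : finType.

Definition vpairs : {set {set V}} := [set e : {set V} | #|e| == 2%N].

(* A simple graph on V is its edge set. *)
Record sgraph := SGraph {
  edges : {set {set V}};
  _ : edges \subset vpairs
}.
HB.instance Definition _ := [isSub for edges].
HB.instance Definition _ := [Finite of sgraph by <:].

(* Irreflexive because [set v; v] is not a 2-element set. *)
Definition adj (G : sgraph) : rel V := fun v w => [set v; w] \in edges G.

Lemma adj_sym (G : sgraph) : symmetric (adj G).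
Proof. by move=> v w; rewrite /adj finset.setUC. Qed.

Lemma adj_irr (G : sgraph) : irreflexive (adj G).
Proof.
move=> v; apply/negP => /(fintype.subsetP (valP G)).
by rewrite inE finset.setUid cards1.
Qed.

End SimpleGraphs.

Section HatGuessing.
Variables (V : finType) (G : sgraph V).

Definition nbr (v : V) := {w : V | adj G v w}.

(* The k colors are the elements of 'I_k. *)
Definition coloring (k : nat) := {ffun V -> 'I_k}.

Definition strategy (k : nat) := forall v : V, {ffun nbr v -> 'I_k} -> 'I_k.

Definition seen k (c : coloring k) (v : V) : {ffun nbr v -> 'I_k} :=
  [ffun w => c (val w)].

Definition guesses_correctly k (S : strategy k) (c : coloring k) (v : V) :=
  S v (seen c v) = c v.

Definition winning k (S : strategy k) :=
  forall c : coloring k, exists v, guesses_correctly S c v.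

Definition winnable (k : nat) := (0 < k)%N /\ exists S : strategy k, winning S.

Definition is_HG (k : nat) :=
  winnable k /\ forall k', winnable k' -> (k' <= k)%N.

(* The default value 0 is only taken when V is empty, see HG_spec. *)
Definition HG : nat := xget 0%N [set k | is_HG k]%classic.

Lemma winnable1 : (0 < #|V|)%N -> winnable 1.
Proof.
move=> /card_gt0P[v _]; split=> //; exists (fun _ _ => ord0) => c.
by exists v; rewrite /guesses_correctly [RHS]ord1.
Qed.

Lemma winnable_le_card k : winnable k -> (k <= #|V|)%N.
Proof.
move=> [k0 [S winS]].
pose C v := [set c : coloring k | S v (seen c v) == c v].
have cardC v : (#|C v| * k <= #|{: coloring k}|)%N.
  pose f (cj : coloring k * 'I_k) : coloring k :=
    [ffun w => if w == v then cj.2 else cj.1 w].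
  rewrite -[X in (_ * X)%N]card_ord -[#|{: 'I_k}|]cardsT -cardsX.
  rewrite -(@card_in_imset _ _ f) ?max_card // => -[c i] [d j].
  rewrite !inE !andbT /= => /eqP cv /eqP dv /ffunP fE.
  have cd w : w != v -> c w = d w.
    by move=> /negPf wv; have := fE w; rewrite !ffunE wv.
  have -> : i = j by have := fE v; rewrite !ffunE eqxx.
  congr pair; apply/ffunP => w; have [->|] := eqVneq w v; last exact: cd.
  rewrite -cv -dv; congr (S v _); apply/ffunP => u; rewrite !ffunE.
  apply: cd; apply/eqP => uv; have := valP u.
  by rewrite uv adj_irr.
have N0 : (0 < #|{: coloring k}|)%N.
  by apply/card_gt0P; exists [ffun=> Ordinal k0].
have cover : (#|{: coloring k}| <= \sum_v #|C v|)%N.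
  rewrite -cardsT.
  have <- : (\bigcup_v C v)%SET = [set: coloring k]%SET.
    apply/setP => c; rewrite !inE; apply/finset.bigcupP.
    by have [v cv] := winS c; exists v => //; rewrite inE; apply/eqP.
  elim/big_rec2 : _ => [|v n A _ An]; first by rewrite cards0.
  by rewrite (leq_trans (leq_card_setU _ _)) // leq_add2l.
rewrite -(leq_pmul2l N0) (leq_trans (leq_mul cover (leqnn k))) //.
rewrite big_distrl /= mulnC -sum_nat_const.
by apply: leq_sum => v _; apply: cardC.
Qed.

Lemma HG_spec : (0 < #|V|)%N -> is_HG HG.
Proof.
move=> V0; rewrite /HG; case: xgetP => // none; exfalso.
have exw : exists k, `[< winnable k >] by exists 1%N; apply/asboolP/winnable1.
have bw k : `[< winnable k >] -> (k <= #|V|)%N by move/asboolP/winnable_le_card.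
case: (ex_maxnP exw bw) => k /asboolP wk kmax; apply: (none k).
by split=> // k' wk'; apply: kmax; apply/asboolP.
Qed.

End HatGuessing.

Section RandomGraphs.
Variable R : realType.

(* Law of the random graph on V in which the possible edges are present
   independently, each with probability p. *)
Definition Gnp_weight (V : finType) (p : R) (G : sgraph V) : R :=
  \prod_(e in vpairs V) (if e \in edges G then p else 1 - p).

Definition Gnp_prob (V : finType) (p : R) (A : pred (sgraph V)) : R :=
  \sum_(G : sgraph V | A G) Gnp_weight p G.

Lemma Gnp_prob_total (V : finType) (p : R) : Gnp_prob p (@predT (sgraph V)) = 1.
Proof.
pose F e := if e \in vpairs V then p else 0.
pose F' e := if e \in vpairs V then 1 - p else 1.
have <- : \prod_e (F e + F' e) = 1.
  rewrite big1 // => e _; rewrite /F /F'.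
  by case: ifP; rewrite ?add0r // addrC subrK.
rewrite bigA_distr.
rewrite [RHS](bigID (fun E : {set {set V}} => E \subset vpairs V)) /=.
rewrite addrC big1; last first.
  move=> E /subsetPn[e eE /negPf eV].
  by rewrite (bigD1 e) //= eE /F eV mul0r.
rewrite add0r (reindex_omap (@edges V) insub) /=; last first.
  by move=> E sE; rewrite insubT.
apply: eq_big => [G|G _]; first by rewrite (valP G) valK eqxx.
rewrite /Gnp_weight [LHS]big_mkcond /=; apply: eq_bigr => e _; rewrite /F /F'.
case: ifP => // /negbT eV; case: ifP => // eG.
by rewrite (fintype.subsetP (valP G) _ eG) in eV.
Qed.

End RandomGraphs.

(* Main.v *)
Require Import Defs.
From mathcomp Require Import all_boot all_order all_algebra.
From mathcomp Require Import all_classical all_reals all_analysis.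
From mathcomp Require Import ring lra.
Import Order.TTheory GRing.Theory Num.Theory.
Import numFieldNormedType.Exports.
Local Open Scope classical_set_scope.
Local Open Scope ring_scope.

Set Implicit Arguments.
Unset Strict Implicit.
Unset Printing Implicit Defensive.

(* Colour the n vertices uniformly with k colours and let A_u be the event that
   u guesses correctly.  As in the local lemma, for u outside T,
   P(A_u and no T) <= P(no (T \ N(u))) / k, so if P(A_w | no (T \ N(u))) <= q
   for the at most m vertices w of T in N(u), then
   P(A_u | no T) <= 1 / (k (1 - m q)).
   In the random graph |T :&: N(u)| and |T \ N(u)| are about half of |T| for the
   sets T that occur, namely common non-neighbourhoods of at most three
   vertices.  Fixing a vertex v and starting from T = V \ N[v], three rounds
   pass from sets of size n/2 to n/4 to n/8, where the union bound 1 / (k - |T|)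
   is used instead.  For k >= 55/68 n this gives P(A_u | no T) <= 1.995 / n for u
   in N(v), hence P(no V) > 0 and the strategy loses.  As 55/68 < (1 + sqrt 5) / 4,
   delta = 0 is enough.
   The degree estimates follow from a Chernoff bound for the number X of
   vertices with a prescribed adjacency pattern to j given ones: (1 + eps)^X is
   the sum of eps^|Z| over the sets Z of such vertices, and each Z occurs with
   probability 2^(-j|Z|). *)

(** * Counting colourings in which no vertex of a set guesses correctly *)

Section Avoid.
Variables (V : finType) (G : sgraph V) (k : nat) (S : strategy G k).
Implicit Types (u v w : V) (T : {set V}) (c : coloring V k).

Definition nbhd u : {set V} := [set w | adj G u w]%SET.

Definition right u c : bool := @S u (seen G c u) == c u.

Definition avoid T : {set coloring V k} :=
  [set c | [forall u in T, ~~ right u c]]%SET.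

(** A bound [#|hits u T| <= r * #|avoid T|] plays the role of P(A_u | no T) <= r. Comparing counts
    avoids dividing by a possibly empty [avoid T]. *)
Definition hits u T : {set coloring V k} := [set c in avoid T | right u c]%SET.

Lemma avoidS {T} T' : T' \subset T -> avoid T \subset avoid T'.
Proof.
move=> /fintype.subsetP sT; apply/fintype.subsetP => c.
rewrite !inE => /forall_inP cT.
by apply/forall_inP => w /sT/cT.
Qed.

Lemma hitsS u {T} T' : T' \subset T -> hits u T \subset hits u T'.
Proof.
move=> /avoidS/fintype.subsetP sT; apply/fintype.subsetP => c.
by move=> /setIdP[/sT cT' cu]; apply/setIdP.
Qed.

Lemma seen_recolor {u w c} {d : coloring V k} :
  ~~ adj G w u -> (forall x, x != u -> c x = d x) -> seen G c w = seen G d w.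
Proof.
move=> wu cd; apply/ffunP => x; rewrite !ffunE; apply: cd.
by apply: contraNneq wu => <-; exact: (valP x).
Qed.

(* Once the other colours are fixed, u is right for exactly one of its k
   colours, and recolouring u only affects guesses in nbhd u. *)
Lemma card_hits {u T} : u \notin T ->
  (#|hits u T| * k <= #|avoid (T :\: nbhd u)|)%N.
Proof.
move=> uT.
pose f (cj : coloring V k * 'I_k) : coloring V k :=
  [ffun w => if w == u then cj.2 else cj.1 w].
rewrite -[X in (_ * X)%N]card_ord -[#|{: 'I_k}|]cardsT -cardsX.
rewrite -(@card_in_imset _ _ f); last first.
  move=> [c i] [d j]; rewrite !inE !andbT /=.
  move=> /andP[_ /eqP cv] /andP[_ /eqP dv] /ffunP fE.
  have cd w : w != u -> c w = d w.
    by move=> /negPf wv; have := fE w; rewrite !ffunE wv.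
  have -> : i = j by have := fE u; rewrite !ffunE eqxx.
  congr pair; apply/ffunP => w; have [->|] := eqVneq w u; last exact: cd.
  by rewrite -cv -dv; congr (@S u _); apply: seen_recolor cd; rewrite adj_irr.
apply/subset_leq_card/fintype.subsetP => d /imsetP[[c i]].
rewrite !inE andbT /= => /andP[/forall_inP cT _] ->{d}.
apply/forall_inP => w; rewrite !inE => /andP[uw wT].
have := cT w wT; rewrite /right !ffunE.
have -> : (w == u) = false by apply: contraNF uT => /eqP <-.
rewrite (@seen_recolor u w c (f (c, i))) ?(adj_sym _ w) // => x /negPf xu.
by rewrite ffunE xu.
Qed.

Lemma card_avoid_le T' T :
  (#|avoid T'| <= #|avoid T| + \sum_(w in T :\: T') #|hits w T'|)%N.
Proof.
have sub : avoid T' \subset avoid T :|: \bigcup_(w in T :\: T') hits w T'.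
  apply/fintype.subsetP => c cT'; rewrite finset.in_setU.
  have [//|cT] := boolP (c \in avoid T); apply/finset.bigcupP.
  move: cT; rewrite inE negb_forall_in => /exists_inP[w wT /negPn cw].
  exists w; last exact/setIdP.
  rewrite inE wT andbT; apply/negP => wT'.
  by move: cT'; rewrite inE => /forall_inP/(_ w wT'); rewrite cw.
apply: leq_trans (subset_leq_card sub) _.
apply: leq_trans (leq_card_setU _ _) _; rewrite leq_add2l.
elim/big_rec2 : _ => [|w m A _ Am]; first by rewrite cards0.
by rewrite (leq_trans (leq_card_setU _ _)) // leq_add2l.
Qed.

Lemma winning_avoid : winning S -> avoid [set: V]%SET = finset.set0.
Proof.
move=> winS; apply/setP => c; rewrite !inE; apply/negP => /forall_inP cN.
have [v /eqP cv] := winS c; move: (cN v (finset.in_setT v)).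
by rewrite /right cv.
Qed.

Context {R : realFieldType}.
Implicit Types (m q r : R).

(** Union bound conditional on [avoid T']: at most m further vertices have to be avoided, and each
    of them costs at most a share q of [avoid T']. *)
Lemma avoid_ge {T' T m q} : 0 <= q -> #|T :\: T'|%:R <= m ->
    (forall w, w \in T :\: T' -> #|hits w T'|%:R <= q * #|avoid T'|%:R) ->
  (1 - m * q) * #|avoid T'|%:R <= #|avoid T|%:R.
Proof.
move=> q0 Tm hq; have := card_avoid_le T' T.
rewrite -(ler_nat R) natrD natr_sum.
have : \sum_(w in T :\: T') #|hits w T'|%:R <= m * (q * #|avoid T'|%:R).
  apply: le_trans (ler_sum _ hq) _; rewrite sumr_const -(mulr_natl (q * _)).
  by apply: ler_wpM2r; rewrite // mulr_ge0.
lra.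
Qed.

(** One round of the recursion. [card_hits] bounds the numerator through [avoid (T :\: nbhd u)], and
    [avoid_ge] shows that passing from there to [avoid T] loses at most the factor 1 - m q. *)
Lemma hits_le {u T m q r} : u \notin T -> 0 <= q -> 0 <= r ->
    #|T :&: nbhd u|%:R <= m -> 1 <= r * (k%:R * (1 - m * q)) ->
    (forall w, w \in T :&: nbhd u ->
       #|hits w (T :\: nbhd u)|%:R <= q * #|avoid (T :\: nbhd u)|%:R) ->
  #|hits u T|%:R <= r * #|avoid T|%:R.
Proof.
move=> uT q0 r0 Tm rk hq.
have DD : T :\: (T :\: nbhd u) = T :&: nbhd u
  by rewrite finset.setDDr finset.setDv finset.set0U.
have := @avoid_ge (T :\: nbhd u) T m q q0; rewrite DD => /(_ Tm hq) aT.
have := card_hits uT; rewrite -(ler_nat R) natrM => hk.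
set h := #|hits u T|%:R in hk *.
apply: le_trans (ler_wpM2l r0 aT).
have h0 : 0 <= h by [].
have k0 : 0 <= k%:R :> R by [].
(* A negative value would make r k (1 - m q) at most 0, against [rk]. *)
have mq0 : 0 <= r * (1 - m * q).
  by rewrite leNgt; apply/negP => ?; nra.
rewrite mulrA; apply: le_trans (ler_wpM2l mq0 hk).
nra.
Qed.

Lemma hits0_le u :
  (0 < k)%N ->
  #|hits u finset.set0|%:R <= k%:R^-1 * #|avoid finset.set0|%:R :> R.
Proof.
move=> k0; rewrite ler_pdivlMl ?ltr0n // mulrC -natrM ler_nat.
by rewrite -[X in avoid X](finset.set0D (nbhd u)) card_hits ?inE.
Qed.

Lemma avoid_ge_card {T m} : (0 < k)%N -> #|T|%:R <= m ->
  (1 - m / k%:R) * #|avoid finset.set0|%:R <= #|avoid T|%:R.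
Proof.
move=> k0 Tm; apply: avoid_ge; rewrite ?finset.setD0 ?invr_ge0 // => w _.
exact: hits0_le.
Qed.

(** Base case of the recursion. Dropping the condition leaves P(A_u) <= 1 / k in the numerator, and
    the plain union bound gives P(no T) >= 1 - m / k. *)
Lemma hits_le_card {u T m r} : 0 <= r -> #|T|%:R <= m ->
  1 <= r * (k%:R - m) -> #|hits u T|%:R <= r * #|avoid T|%:R.
Proof.
move=> r0 Tm rk.
have m0 : 0 <= m by apply: le_trans Tm.
have k0 : 0 < k%:R :> R by rewrite lt_neqAle ler0n andbT; apply/eqP; nra.
have kN0 : (0 < k)%N by rewrite -(ltr0n R).
have hT : #|hits u T|%:R <= #|hits u finset.set0|%:R :> R.
  by rewrite ler_nat subset_leq_card // hitsS // finset.sub0set.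
apply: le_trans hT _; apply: le_trans (hits0_le u kN0) _.
apply: le_trans (ler_wpM2l r0 (avoid_ge_card kN0 Tm)).
rewrite mulrA ler_wpM2r //.
have -> : r * (1 - m / k%:R) = r * (k%:R - m) * k%:R^-1.
  by field; rewrite gt_eqF.
by rewrite ler_peMl // invr_ge0 ltW.
Qed.

Lemma avoid_gt0 {T} : #|T|%:R < k%:R :> R -> 0 < #|avoid T|%:R :> R.
Proof.
move=> Tk; have kR0 : 0 < k%:R :> R by apply: le_lt_trans Tk.
have k0 : (0 < k)%N by rewrite -(ltr0n R).
apply: lt_le_trans (avoid_ge_card k0 (lexx _)); apply: mulr_gt0.
  by rewrite subr_gt0 ltr_pdivrMr // mul1r.
rewrite ltr0n; apply/card_gt0P; exists [ffun=> Ordinal k0].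
by rewrite inE; apply/forall_inP => w; rewrite inE.
Qed.

End Avoid.

(** * Adjacency patterns, and why regular ones defeat every strategy *)

Section Matches.
Variables (V : finType) (G : sgraph V).
Implicit Types (s : seq (V * bool)).

(** The vertices of s are excluded so that every pair tested is a possible edge and no pair is
    tested twice when s has distinct vertices. *)
Definition matches s : {set V} :=
  [set z | (z \notin unzip1 s) && all (fun p => adj G p.1 z == p.2) s]%SET.

Definition matches_bounded {R : realFieldType} (eps : R) (j : nat) :=
  [forall s : j.-tuple (V * bool), uniq (unzip1 s) ==>
     (#|matches s|%:R <= (2^-1 ^+ j + eps) * #|V|%:R)].

Lemma matches_bounded_le {R : realFieldType} {eps : R} {s} {T : {set V}} :
    matches_bounded eps (size s) -> uniq (unzip1 s) ->
    (forall z, z \in T ->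
       (z \notin unzip1 s) && all (fun p => adj G p.1 z == p.2) s) ->
  #|T|%:R <= (2^-1 ^+ size s + eps) * #|V|%:R.
Proof.
move=> /forallP/(_ (in_tuple s))/implyP H us Ts.
apply: le_trans (H us); rewrite ler_nat subset_leq_card //.
by apply/fintype.subsetP => z /Ts; rewrite inE.
Qed.

(** With n the number of vertices, r3/n, r2/n and r1/n bound the conditional probabilities in the
    three rounds. The inequality on r3 feeds the base case [hits_le_card], those on r2 and r1 feed
    [hits_le], and the last one leaves a positive share of colourings without a correct guess. *)
Lemma matches_bounded_not_winning {R : realFieldType} {k : nat}
    (S : strategy G k) (kap eps r1 r2 r3 : R) (m := fun j => 2^-1 ^+ j + eps) :
    0 <= eps -> (0 < #|V|)%N -> kap * #|V|%:R <= k%:R ->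
    (forall j, (0 < j <= 3)%N -> matches_bounded eps j) ->
    0 <= r1 -> 0 <= r2 -> 0 <= r3 -> m 1%N < kap ->
    0 <= 1 - m 2%N * r2 -> 0 <= 1 - m 3%N * r3 ->
    1 <= r3 * (kap - m 3%N) ->
    1 <= r2 * (kap * (1 - m 3%N * r3)) -> 1 <= r1 * (kap * (1 - m 2%N * r2)) ->
    (m 1%N + #|V|%:R^-1) * r1 < 1 ->
  ~ winning S.
Proof.
move=> eps0 V0 kn bd r1_0 r2_0 r3_0 m1k mr2 mr3 C B A D /winning_avoid aV.
have bd1 := bd 1%N isT; have bd2 := bd 2%N isT; have bd3 := bd 3%N isT.
have [m1 m1E] : {x : R | m 1%N = x} by exists (m 1%N).
have [m2 m2E] : {x : R | m 2%N = x} by exists (m 2%N).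
have [m3 m3E] : {x : R | m 3%N = x} by exists (m 3%N).
have m0 j : 0 <= m j by rewrite addr_ge0 // exprn_ge0 // invr_ge0.
rewrite m1E in m1k D; rewrite m2E in mr2 A; rewrite m3E in mr3 B C.
move: V0 => /[dup] /card_gt0P[v _]; rewrite -(ltr_nat R).
move: kn D; set n : R := #|V|%:R => kn D n0.
have scale r : 0 <= r -> 0 <= r / n by move=> ?; rewrite divr_ge0 // ltW.
have scaleK a r : a * n * (r / n) = a * r by field; rewrite gt_eqF.
have ge1 a r : 1 <= r * (kap * a) -> 0 <= r -> 0 <= a ->
    1 <= r / n * (k%:R * a).
  move=> ra r0 a0; apply: (le_trans ra).
  have -> : r * (kap * a) = r / n * (kap * n * a).
    by field; rewrite gt_eqF.
  by rewrite ler_wpM2l ?scale // ler_wpM2r.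
have adjN x y : adj G x y -> x != y.
  by apply: contraTneq => ->; rewrite adj_irr.
set T := (~: (v |: nbhd G v))%SET.
have inT z : (z \in T) = (z != v) && ~~ adj G v z.
  by rewrite !inE negb_or.
have cardT : #|T|%:R <= m1 * n.
  have := @matches_bounded_le _ _ [:: (v, false)] T bd1 isT.
  rewrite /= -/n => H; apply: (le_trans (H _)) => [z|]; last by rewrite -m1E.
  by rewrite inT !inE andbT eqbF_neg.
have hitsT u : adj G v u ->
    #|hits S u T|%:R <= r1 / n * #|avoid S T|%:R :> R.
  move=> vu; have uT : u \notin T by rewrite inT vu andbF.
  (* Outer round: [T :&: nbhd G u] is a pattern on u and v, hence has at most m2 n vertices. *)
  apply: (@hits_le _ _ _ _ _ _ _ (m2 * n) (r2 / n)).
  - by [].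
  - exact: scale.
  - exact: scale.
  - have := @matches_bounded_le _ _ [:: (u, true); (v, false)]
      (T :&: nbhd G u) bd2.
    rewrite /= -/n !inE andbT eq_sym adjN // => /(_ isT) H.
    apply: (le_trans (H _)) => [z|]; last by rewrite -m2E.
    rewrite finset.in_setI inT !inE !andbT eqbF_neg eqb_id.
    move=> /andP[/andP[zv vz] uz].
    by rewrite negb_or zv eq_sym adjN // uz vz.
  - by rewrite scaleK; apply: ge1.
  move=> w; rewrite finset.in_setI inT inE => /andP[/andP[wv vw] uw].
  set T2 := T :\: nbhd G u.
  have inT2 z : (z \in T2) = [&& z != v, ~~ adj G v z & ~~ adj G u z].
    by rewrite finset.in_setD inT inE andbC andbA.
  have uv : u != v by rewrite eq_sym adjN.
  have wu : w != u by rewrite eq_sym adjN.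
  (* Middle round, conditioned on the common non-neighbours [T2] of u and v. *)
  apply: (@hits_le _ _ _ _ _ _ _ (m3 * n) (r3 / n)).
  - by rewrite inT2 uw !andbF.
  - exact: scale.
  - exact: scale.
  - have := @matches_bounded_le _ _ [:: (w, true); (u, false); (v, false)]
      (T2 :&: nbhd G w) bd3.
    rewrite /= -/n !inE andbT negb_or wu wv uv => /(_ isT) H.
    apply: (le_trans (H _)) => [z|]; last by rewrite -m3E.
    rewrite finset.in_setI inT2 !inE !andbT !eqbF_neg eqb_id.
    move=> /andP[/and3P[zv vz uz] wz].
    rewrite !negb_or zv wz uz vz eq_sym adjN // !andbT /=.
    by apply: contraNneq vz => ->.
  - by rewrite scaleK; apply: ge1.
  (* [T3] avoids the neighbours of u, v and w, so it has at most m3 n vertices and the union bound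
     ends the recursion. *)
  move=> y _; set T3 := T2 :\: nbhd G w.
  apply: (@hits_le_card _ _ _ _ _ _ _ (m3 * n)).
  - exact: scale.
  - have := @matches_bounded_le _ _ [:: (w, false); (u, false); (v, false)]
      T3 bd3.
    rewrite /= -/n !inE andbT negb_or wu wv uv => /(_ isT) H.
    apply: (le_trans (H _)) => [z|]; last by rewrite -m3E.
    rewrite finset.in_setD inT2 !inE !andbT !eqbF_neg.
    move=> /andP[wz /and3P[zv vz uz]].
    rewrite !negb_or zv wz uz vz !andbT /=.
    apply/andP; split; first by apply: contraNneq uz => ->.
    by apply: contraNneq vz => ->.
  - apply: (@le_trans _ _ (r3 / n * ((kap - m3) * n))).
      by rewrite mulrC scaleK; lra.
    by rewrite ler_wpM2l ?scale //; lra.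
have aT0 : 0 < #|avoid S T|%:R :> R.
  apply: avoid_gt0; apply: (le_lt_trans cardT); apply: lt_le_trans kn.
  by rewrite ltr_pM2r.
(* The complement of T is the closed neighbourhood of v; the summand 1 counts v itself. *)
have : (1 - (m1 * n + 1) * (r1 / n)) * #|avoid S T|%:R
    <= #|avoid S [set: V]%SET|%:R :> R.
  apply: avoid_ge; first exact: scale.
    have := @matches_bounded_le _ _ [:: (v, true)] (nbhd G v) bd1 isT.
    rewrite /= -/n -/(m 1%N) m1E => H; rewrite finset.setTD finset.setCK.
    rewrite cardsU1 inE adj_irr natrD (addrC 1) lerD2r; apply: H => z.
    rewrite !inE andbT eqb_id => vz; by rewrite eq_sym adjN.
  move=> w; rewrite finset.setTD finset.setCK.
  move=> /finset.setU1P[->|]; last first.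
    by rewrite inE => /hitsT.
  have vT : v \notin T by rewrite inT eqxx.
  have Tv : T :&: nbhd G v = finset.set0.
    apply/setP => z; rewrite finset.in_setI inT !inE.
    by case: (adj _ _ _); rewrite ?andbF.
  (* As v has no neighbour in T, its conditional probability is at most 1 / k. *)
  apply: (@hits_le _ _ _ _ _ _ _ 0 0) => //; first exact: scale.
  - by rewrite Tv cards0.
  - rewrite mulr0 subr0; apply: ge1 => //; apply: (le_trans A).
    rewrite mulr1 ler_wpM2l // ler_piMr //.
      by apply: ltW; apply: le_lt_trans m1k; rewrite -m1E.
    by rewrite gerBl mulr_ge0 // -m2E.
  by move=> y; rewrite Tv inE.
rewrite aV cards0; apply/negP; rewrite -ltNge mulr_gt0 // subr_gt0.
have -> : m1 * n + 1 = (m1 + n^-1) * n by rewrite mulrDl mulVf ?gt_eqF.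
by rewrite scaleK.
Qed.
End Matches.

Lemma HG_le_golden {R : rcfType} {V : finType} {G : sgraph V} :
    (2000 <= #|V|)%N ->
    (forall j, (0 < j <= 3)%N -> matches_bounded G (2000^-1 : R) j) ->
  (HG G)%:R <= (1 + Num.sqrt 5) / 4 * #|V|%:R :> R.
Proof.
move=> V2000 bd; have V0 : (0 < #|V|)%N by apply: leq_trans V2000.
have [[_ [S winS]] _] := HG_spec G V0.
rewrite leNgt; apply/negP => /ltW kV.
have n1 : #|V|%:R^-1 <= 2000^-1 :> R by rewrite lef_pV2 ?posrE ?ltr0n ?ler_nat.
(* 38 / 17 lies just below sqrt 5, since 38^2 = 1444 and 5 * 17^2 = 1445; and 55 / 68 = (1 + 38 /
   17) / 4. *)
have s5 : 55 / 68 <= (1 + Num.sqrt 5) / 4 :> R.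
  have : 38 / 17 <= Num.sqrt 5 :> R.
    have -> : 38 / 17 = Num.sqrt ((38 / 17) ^+ 2) :> R.
      by rewrite sqrtr_sqr ger0_norm //; lra.
    rewrite ler_wsqrtr //; lra.
  lra.
have kV' : 55 / 68 * #|V|%:R <= (HG G)%:R :> R.
  by apply: le_trans kV; rewrite ler_wpM2r.
move: n1; set i := #|V|%:R^-1 => n1.
(* Each r is a fraction slightly above the least value that its inequality allows. For eps = 0 and
   large n the rounds only need kap > (4 + sqrt 6) / 8, about 0.806, which leaves room for eps and
   1/n up to 1/2000. *)
apply: (@matches_bounded_not_winning _ _ _ _ S (55 / 68) 2000^-1
  (399 / 200) (47 / 31) (22 / 15)) winS.
1,5-13: by clear; lra.
- exact: V0.
- exact: kV'.
- exact: bd.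
rewrite -/i; move: i n1; clear => i n1; lra.
Qed.

(** * Chernoff bound for adjacency patterns in the random graph *)

Section Probability.
Context {R : realType} {V : finType}.
Implicit Types (G : sgraph V) (A B : pred (sgraph V)) (p x : R).

Lemma Gnp_weight_ge0 {p} G : 0 <= p <= 1 -> 0 <= Gnp_weight p G.
Proof.
move=> /andP[p0 p1]; apply: prodr_ge0 => e _.
by case: ifP; rewrite ?subr_ge0.
Qed.

Lemma Gnp_prob_ge0 {p} A : 0 <= p <= 1 -> 0 <= Gnp_prob p A.
Proof. by move=> p01; apply: sumr_ge0 => G _; apply: Gnp_weight_ge0. Qed.

Lemma Gnp_prob_le {p A B} : 0 <= p <= 1 -> (forall G, A G -> B G) ->
  Gnp_prob p A <= Gnp_prob p B.
Proof.
move=> p01 AB; rewrite /Gnp_prob [leRHS]big_mkcond [leLHS]big_mkcond /=.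
apply: ler_sum => G _; case: ifP => [/AB ->//|_].
by case: ifP => // _; apply: Gnp_weight_ge0.
Qed.

Lemma Gnp_probC p A : Gnp_prob p A + Gnp_prob p (predC A) = 1.
Proof. by rewrite -(Gnp_prob_total V p) /Gnp_prob [RHS](bigID A). Qed.

Lemma Gnp_prob_exists {p} {I : finType} (A : I -> pred (sgraph V)) :
    0 <= p <= 1 ->
  Gnp_prob p (fun G => [exists i, A i G]) <= \sum_i Gnp_prob p (A i).
Proof.
move=> p01; rewrite /Gnp_prob; under [leRHS]eq_bigr do rewrite big_mkcond /=.
rewrite exchange_big [leLHS]big_mkcond /=. apply: ler_sum => G _.
have AG0 i : 0 <= if A i G then Gnp_weight p G else 0.
  by case: ifP => // _; apply: Gnp_weight_ge0.
case: ifP => [/existsP[i Ai]|_]; last exact: sumr_ge0.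
by rewrite (bigD1 i) //= Ai lerDl sumr_ge0.
Qed.

(** Expanding a product of sums (present + absent) over all e gives a sum over edge sets. Zeroing
    the choice that contradicts b on D keeps just the wanted graphs; each e in D then contributes
    1/2, every other e contributes 1. *)
Lemma Gnp_half_pattern {D : {set {set V}}} (b : pred {set V}) :
    D \subset vpairs V ->
  Gnp_prob (2^-1 : R) (fun G => [forall e in D, (e \in edges G) == b e]) =
    2^-1 ^+ #|D|.
Proof.
move=> /fintype.subsetP DV.
pose F e : R := if e \in vpairs V then if (e \in D) ==> b e then 2^-1 else 0
  else 0.
pose F' e : R := if e \in vpairs V then if (e \in D) ==> ~~ b e then 2^-1 else 0
  else 1.
have half : 1 - 2^-1 = 2^-1 :> R by lra.
have <- : \prod_e (F e + F' e) = 2^-1 ^+ #|D|.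
  rewrite -prodr_const [RHS]big_mkcond /=; apply: eq_bigr => e _.
  rewrite /F /F'; case: (boolP (e \in D)) => [/DV -> /=|_].
    by case: (b e); rewrite ?addr0 ?add0r.
  by case: ifP => _ /=; lra.
rewrite bigA_distr.
rewrite [RHS](bigID (fun E : {set {set V}} => E \subset vpairs V)) /=.
rewrite [X in _ = _ + X]big1; last first.
  move=> E /subsetPn[e eE /negPf eV].
  by rewrite (bigD1 e) //= eE /F eV mul0r.
rewrite addr0 (reindex_omap (@edges V) insub) /=; last first.
  by move=> E sE; rewrite insubT.
rewrite /Gnp_prob big_mkcond [RHS]big_mkcond; apply: eq_bigr => G _ /=.
rewrite (valP G) valK eqxx /=; case: ifP => [/forall_inP GD|]; last first.
  move=> /negbT; rewrite negb_forall_in => /exists_inP[e eD eG].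
  rewrite (bigD1 e) //= /F /F' (DV e eD) eD /=.
  by case: ifP eG => _; case: (b e) => //= _; rewrite mul0r.
rewrite /Gnp_weight [LHS]big_mkcond /=; apply: eq_bigr => e _; rewrite /F /F'.
rewrite half if_same; case: ifP => [_|/negbT eV].
  case: (boolP (e \in D)) => [/GD/eqP <-|_]; last by rewrite if_same.
  by case: (e \in edges G).
by case: ifP => // /(fintype.subsetP (valP G)); rewrite (negPf eV).
Qed.

Lemma Gnp_half_matches {s : seq (V * bool)} {Z : {set V}} :
    uniq (unzip1 s) -> (forall z, z \in Z -> z \notin unzip1 s) ->
  Gnp_prob (2^-1 : R) (fun G => Z \subset matches G s) =
    (2^-1 ^+ size s) ^+ #|Z|.
Proof.
move=> us Zs.
pose f (q : (V * bool) * V) : {set V} := [set q.1.1; q.2]%SET.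
pose P : {set V * bool} := [set p in s]%SET.
pose D := f @: finset.setX P Z.
(* An edge in D contains exactly one vertex of s, so b recovers the prescribed bit from the edge
   alone. *)
pose b (e : {set V}) := has (fun p : V * bool => (p.1 \in e) && p.2) s.
have s1 (p q : V * bool) : p \in s -> q \in s -> p.1 = q.1 -> p = q.
  move=> ps qs /eqP pq; apply/eqP; rewrite -(nth_index p ps) -(nth_index p qs).
  rewrite -(nth_index p ps) -(nth_index p qs) in pq.
  rewrite -!(nth_map _ p.1) ?index_mem // in pq.
  rewrite nth_uniq ?size_map ?index_mem // in pq.
  by rewrite (eqP pq).
have s2 (p : V * bool) z : p \in s -> z \in Z -> p.1 != z.
  by move=> ps /Zs; apply: contraNneq => <-; apply: map_f.
have cardD : #|D| = (size s * #|Z|)%N.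
  rewrite card_in_imset ?cardsX.
    by rewrite cardsE; move/card_uniqP: (map_uniq us) => ->.
  move=> [p y] [q z]; rewrite !inE /= => /andP[ps yZ] /andP[qs zZ] /setP pq.
  have := pq p.1; have := pq y; rewrite !inE !eqxx orbT /=.
  rewrite (negPf (s2 p z ps zZ)) orbF => + /esym/eqP/s1 -> //.
  by rewrite eq_sym (negPf (s2 q y qs yZ)) => /esym/eqP ->.
have bE (p : V * bool) z : p \in s -> z \in Z -> b [set p.1; z]%SET = p.2.
  move=> ps zZ; apply/hasP/idP => [[q qs]|p2]; last first.
    by exists p; rewrite // !inE eqxx.
  by rewrite !inE (negPf (s2 q z qs zZ)) orbF => /andP[/eqP/s1 -> //].
have DV : D \subset vpairs V.
  apply/fintype.subsetP => _ /imsetP[[p z] /finset.setXP[/= ps zZ] ->].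
  by rewrite inE in ps; rewrite inE cards2 s2.
rewrite -exprM -cardD -(Gnp_half_pattern b DV); apply: eq_bigl => G.
apply/fintype.subsetP/forall_inP => [ZG _ /imsetP[[p z] + ->]|DG z zZ].
  move=> /finset.setXP[/= ps zZ]; rewrite inE in ps.
  rewrite bE //; have := ZG z zZ.
  by rewrite inE => /andP[_ /allP/(_ p ps)].
rewrite inE Zs //=; apply/allP => p ps.
rewrite -[X in _ == X](bE p z) //; apply: (DG (f (p, z))).
  by apply: imset_f; rewrite !inE ps.
Qed.

Lemma sum_subset_exprn (W : {set V}) x :
  \sum_(Z : {set V} | Z \subset W) x ^+ #|Z| = (1 + x) ^+ #|W|.
Proof.
pose F z := if z \in W then x else 0.
transitivity (\prod_z (F z + 1)); last first.
  rewrite -prodr_const [RHS]big_mkcond; apply: eq_bigr => z _.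
  by rewrite /F addrC; case: ifP => // _; rewrite addr0.
rewrite bigA_distr big_mkcond; apply: eq_bigr => Z _ /=.
case: ifP => [/fintype.subsetP ZW|/negbT/subsetPn[z zZ /negPf zW]].
  rewrite -prodr_const big_mkcond; apply: eq_bigr => z _.
  by case: ifP => // /ZW zW; rewrite /F zW.
by rewrite (bigD1 z) //= zZ /F zW mul0r.
Qed.

Lemma Gnp_half_matches_tail {s : seq (V * bool)} {eps : R} :
    uniq (unzip1 s) -> 0 < eps ->
  Gnp_prob (2^-1 : R)
    (fun G => ~~ (#|matches G s|%:R <= (2^-1 ^+ size s + eps) * #|V|%:R)) <=
  expR (- (eps ^+ 2 * (1 - 2^-1 ^+ size s) / (1 + eps) * #|V|%:R)).
Proof.
move=> us eps0; set p := 2^-1 ^+ size s; set n : R := #|V|%:R.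
have p0 : 0 <= p by rewrite exprn_ge0 // invr_ge0.
have n0 : 0 <= n by [].
pose w G := Gnp_weight (2^-1 : R) G.
have w0 G : 0 <= w G by apply: Gnp_weight_ge0; lra.
have eps1 : 1 + eps != 0 by rewrite gt_eqF // addr_gt0.
(* lam is a rational lower bound for ln (1 + eps): exp (-lam) >= 1 - lam = 1 / (1 + eps). *)
pose lam := eps / (1 + eps); pose a := (p + eps) * n.
have lam0 : 0 <= lam by rewrite divr_ge0 // ltW // addr_gt0.
have lamE : expR lam <= 1 + eps.
  rewrite -[1 + eps]invrK -[lam]opprK expRN.
  rewrite lef_pV2 ?posrE ?expR_gt0 //; last first.
    by rewrite invr_gt0 addr_gt0.
  apply: le_trans (expR_ge1Dx _).
  by rewrite le_eqVlt; apply/orP; left; apply/eqP; rewrite /lam; field.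
pose C : {set V} := [set z | z \notin unzip1 s]%SET.
have mC G : matches G s \subset C.
  by apply/fintype.subsetP => z; rewrite !inE => /andP[].
(* Markov's inequality: on the bad event (1 + eps)^X >= exp (lam a), and the inner sum is the subset
   expansion of (1 + eps)^X. *)
apply: (@le_trans _ _ (\sum_G expR (- (lam * a)) *
  \sum_(Z : {set V} | Z \subset C)
    (if Z \subset matches G s then eps ^+ #|Z| * w G else 0))).
  rewrite /Gnp_prob big_mkcond /=; apply: ler_sum => G _.
  have -> : \sum_(Z : {set V} | Z \subset C)
      (if Z \subset matches G s then eps ^+ #|Z| * w G else 0) =
      (1 + eps) ^+ #|matches G s| * w G.
    rewrite -sum_subset_exprn mulr_suml -big_mkcondr /=; apply: eq_bigl => Z.
    by apply: andb_idl => /fintype.subset_trans; apply.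
  have t0 : 0 <= (1 + eps) ^+ #|matches G s|.
    by rewrite exprn_ge0 // addr_ge0 // ltW.
  case: ifP => [|_]; last by rewrite !mulr_ge0 // expR_ge0.
  rewrite -ltNge => aX; rewrite mulrA ler_peMl ?w0 // expRN.
  rewrite ler_pdivlMl ?expR_gt0 // mulr1.
  apply: (@le_trans _ _ (expR (lam * #|matches G s|%:R))).
    by rewrite ler_expR ler_wpM2l // ltW.
  by rewrite expRM_natr lerXn2r ?nnegrE ?expR_ge0 // addr_ge0 // ltW.
rewrite -mulr_sumr exchange_big /=.
have -> : \sum_(Z : {set V} | Z \subset C) \sum_G
   (if Z \subset matches G s then eps ^+ #|Z| * w G else 0) =
   (1 + eps * p) ^+ #|C|.
  rewrite -sum_subset_exprn; apply: eq_bigr => Z /fintype.subsetP ZC.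
  rewrite -big_mkcond -mulr_sumr exprMn -(Gnp_half_matches us) // => z /ZC.
  by rewrite inE.
apply: (@le_trans _ _ (expR (- (lam * a)) * expR (eps * p * n))).
  rewrite ler_wpM2l ?expR_ge0 // expRM_natr.
  apply: (@le_trans _ _ (expR (eps * p) ^+ #|C|)).
    rewrite lerXn2r ?nnegrE ?expR_ge0 ?expR_ge1Dx //.
    by rewrite addr_ge0 // mulr_ge0 // ltW.
  rewrite ler_weXn2l ?max_card //.
  by rewrite -expR0 ler_expR mulr_ge0 // ltW.
rewrite -expRD ler_expR le_eqVlt; apply/orP; left; apply/eqP.
by rewrite /lam /a; field.
Qed.

(** Union bound over the (2n)^j patterns; as j > 0, the factor 1 - 2^(-j) of the tail bound is at
    least 1/2. *)
Lemma Gnp_half_matches_bounded (j : nat) {eps : R} : (0 < j)%N -> 0 < eps ->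
  Gnp_prob (2^-1 : R) (fun G => ~~ matches_bounded G eps j) <=
  (#|V| * 2)%:R ^+ j * expR (- (eps ^+ 2 / 2 / (1 + eps) * #|V|%:R)).
Proof.
move=> j0 eps0; have half01 : 0 <= (2^-1 : R) <= 1 by lra.
pose A (s : j.-tuple (V * bool)) G := uniq (unzip1 s) &&
  ~~ (#|matches G s|%:R <= (2^-1 ^+ j + eps) * #|V|%:R).
apply: (@le_trans _ _ (Gnp_prob (2^-1 : R) (fun G => [exists s, A s G]))).
  apply: Gnp_prob_le => // G; rewrite negb_forall.
  by move=> /existsP[s]; rewrite negb_imply => ?; apply/existsP; exists s.
apply: le_trans (Gnp_prob_exists _ half01) _.
set E := expR _.
have <- : \sum_(s : j.-tuple (V * bool)) E = (#|V| * 2)%:R ^+ j * E.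
  by rewrite sumr_const card_tuple card_prod card_bool -natrX mulr_natl.
apply: ler_sum => s _; rewrite /A; case: (boolP (uniq _)) => us /=; last first.
  by rewrite /Gnp_prob big_pred0 ?expR_ge0.
have := @Gnp_half_matches_tail s eps us eps0.
rewrite size_tuple => H; apply: (le_trans H).
rewrite ler_expR lerN2; apply: ler_wpM2r => //; apply: ler_wpM2r.
  by rewrite invr_ge0 addr_ge0 // ltW.
apply: ler_wpM2l; first by rewrite exprn_ge0 // ltW.
have : 2^-1 ^+ j <= 2^-1 :> R by rewrite -[leRHS]expr1 ler_wiXn2l //; lra.
lra.
Qed.

End Probability.

(** * Passage to the limit *)

Lemma cvg_exprn_expRN {R : realType} (j : nat) {c : R} : 0 < c ->
  (n * 2)%:R ^+ j * expR (- (c * n%:R)) @[n --> \oo] --> (0 : R).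
Proof.
(* K is chosen so that K / (n+1) times the term of degree j+1 of exp (c n) equals (2n)^(j+1) /
   (n+1), which is at least (2n)^j once n >= 1. *)
move=> c0; pose K : R := 2 ^+ j.+1 * (j.+1)`!%:R / c ^+ j.+1.
apply: (@squeeze_cvgr _ _ _ _ (fun=> 0) (fun n => K * harmonic n)).
- near=> n.
  have n0 : 0 < n%:R :> R by rewrite ltr0n; near: n; exact: nbhs_infty_gt.
  rewrite mulr_ge0 ?exprn_ge0 ?expR_ge0 //= expRN ler_pdivrMr ?expR_gt0 //.
  have cn0 : 0 <= c * n%:R by rewrite mulr_ge0 // ltW.
  have := expR_ge1Dxn j cn0; set q := _ / _ => qe.
  have {qe} : q <= expR (c * n%:R) by apply: le_trans qe; rewrite lerDr.
  have K0 : 0 <= K by rewrite /K !mulr_ge0 ?invr_ge0 ?exprn_ge0 // ltW.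
  move=> /(ler_wpM2l (_ : 0 <= K / n.+1%:R)) h.
  apply: le_trans (h _); last by rewrite divr_ge0.
  have -> : K / n.+1%:R * q = (n * 2)%:R ^+ j * ((n * 2)%:R / n.+1%:R).
    rewrite /K /q !natrM !exprMn !exprSr; field.
    by rewrite !gt_eqF ?exprn_gt0 ?ltr0n ?fact_gt0 //= nat1r.
  rewrite ler_peMr ?exprn_ge0 // ler_pdivlMr // mul1r ler_nat.
  by rewrite muln2 -addnn -addn1 leq_add2l -(ltr0n R).
- exact: cvg_cst.
- by rewrite -(mulr0 K); apply: cvgM; [exact: cvg_cst|exact: cvg_harmonic].
Unshelve. all: by end_near.
Qed.

Theorem corollary1 (R : realType) :
  exists delta : nat -> R,
    (delta n @[n --> \oo] --> (0 : R)) /\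
    (Gnp_prob (2^-1 : R)
       (fun G : sgraph 'I_n =>
          (HG G)%:R <= (1 + delta n) * ((1 + Num.sqrt 5) / 4) * n%:R)
     @[n --> \oo] --> (1 : R)).
Proof.
exists (fun=> 0); split; first exact: cvg_cst.
have half01 : 0 <= (2^-1 : R) <= 1 by lra.
(* eps is kept opaque: unification could unfold the unary numeral 2000. *)
have [eps epsE] : {e : R | e = 2000^-1} by exists 2000^-1.
have eps0 : 0 < eps by rewrite epsE invr_gt0 ltr0n.
pose c := eps ^+ 2 / 2 / (1 + eps).
have c0 : 0 < c by rewrite !divr_gt0 ?exprn_gt0 ?addr_gt0.
(* Failure probability summed over the pattern lengths 1, 2, 3, hence the shift [j.+1]. *)
pose f n : R := \sum_(j < 3) (n * 2)%:R ^+ j.+1 * expR (- (c * n%:R)).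
have f0 : f n @[n --> \oo] --> (0 : R).
  suff : f n @[n --> \oo] --> \sum_(j < 3) (0 : R) by rewrite big1.
  apply: cvg_big => [|j _]; first exact: add_continuous.
  exact: cvg_exprn_expRN.
apply: (@squeeze_cvgr _ _ _ _ (fun n => 1 - f n) (fun=> 1)).
- near=> n.
  have n2000 : (2000 <= n)%N by near: n; exact: nbhs_infty_ge.
  set A := fun G : sgraph 'I_n => _.
  apply/andP; split; last first.
    by rewrite -[leRHS](Gnp_probC 2^-1 A) lerDl Gnp_prob_ge0.
  rewrite lerBlDr -[leLHS](Gnp_probC 2^-1 A) lerD2l.
  apply: (@le_trans _ _ (Gnp_prob (2^-1 : R)
    (fun G => [exists j : 'I_3, ~~ matches_bounded G eps j.+1]))).
    apply: Gnp_prob_le => // G; apply: contraR.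
    rewrite negb_exists => /forallP bd; rewrite /A addr0 mul1r.
    have := @HG_le_golden R 'I_n G; rewrite card_ord -epsE; apply => //.
    move=> [//|j] /= j3; have := bd (Ordinal (j3 : (j < 3)%N)).
    by rewrite negbK.
  apply: le_trans (Gnp_prob_exists _ half01) _; apply: ler_sum => j _.
  have := @Gnp_half_matches_bounded R 'I_n j.+1 eps isT eps0.
  by rewrite card_ord.
- rewrite -[X in _ --> X](subr0 1).
  by apply: cvgB; [exact: cvg_cst|exact: f0].
- exact: cvg_cst.
Unshelve. all: by end_near.
Qed.
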